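(* Let $X$ and $P$ be metric spaces and let $Y$ be a vector space with a metric making its vector operations continuous. Let $f:X\times P\to Y$ be a continuous single-valued mapping and let $F:X\rightrightarrows Y$ be a set-valued mapping with closed graph. Let $\mathcal{S}_{GE}:P\rightrightarrows X$ be the solution mapping of the parameterized generalized equation $0\in f(x,p)+F(x)$, that is, $\mathcal{S}_{GE}(p)=\{x\in X : 0\in f(x,p)+F(x)\}$. Let $\overline{p}\in\operatorname{dom}\mathcal{S}_{GE}$. If $\mathcal{S}_{GE}$ is locally compact around $\overline{p}$, then $$\operatorname{Lipusc}\mathcal{S}_{GE}(\overline{p})=\sup_{x\in\mathcal{S}_{GE}(\overline{p})}\operatorname{clm}\mathcal{S}_{GE}(\overline{p},x).$$
   Context: Here $f(x,p)+F(x)=\{f(x,p)+v : v\in F(x)\}$. For a set-valued mapping $\mathcal{M}:P\rightrightarrows X$ between metric spaces, $\operatorname{dom}\mathcal{M}=\{p\in P: \mathcal{M}(p)\neq\emptyset\}$ and $\operatorname{gph}\mathcal{M}=\{(p,x)\in P\times X: x\in\mathcal{M}(p)\}$ (similarly for $F$). The point-to-set distance is $d_X(x,\Omega)=\inf_{z\in\Omega}d_X(x,z)$, with $d_X(x,\emptyset)=+\infty$. Lipschitz upper semicontinuity modulus: for $\overline{p}\in\operatorname{dom}\mathcal{M}$, $\operatorname{Lipusc}\mathcal{M}(\overline{p})\in[0,+\infty]$ is the infimum of all $\kappa\ge 0$ for which there is a neighborhood $V$ of $\overline{p}$ with $d_X(x,\mathcal{M}(\overline{p}))\le\kappa\, d_P(p,\overline{p})$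 for all $p\in V$ and all $x\in\mathcal{M}(p)$ (with $\inf\emptyset=+\infty$). Calmness modulus: for $(\overline{p},\overline{x})\in\operatorname{gph}\mathcal{M}$, $\operatorname{clm}\mathcal{M}(\overline{p},\overline{x})\in[0,+\infty]$ is the infimum of all $\kappa\ge 0$ for which there are neighborhoods $V$ of $\overline{p}$ and $U$ of $\overline{x}$ with $d_X(x,\mathcal{M}(\overline{p}))\le\kappa\, d_P(p,\overline{p})$ for all $p\in V$ and all $x\in\mathcal{M}(p)\cap U$ (with $\inf\emptyset=+\infty$). Locally compact around $\overline{p}$: there is a neighborhood $V$ of $\overline{p}$ whose image $\mathcal{M}(V)=\bigcup_{p\in V}\mathcal{M}(p)$ is relatively compact in $X$ (contained in a compact subset of $X$). *)

(* Defs.v *)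
From HB Require Import structures.
From mathcomp Require Import all_boot all_order all_algebra.
From mathcomp Require Import boolp classical_sets reals ereal topology.

Set Implicit Arguments.
Unset Strict Implicit.
Unset Printing Implicit Defensive.

Import Order.TTheory GRing.Theory Num.Theory.
Import numFieldTopology.Exports.

Local Open Scope classical_set_scope.
Local Open Scope ring_scope.

(* The metric and the linear structure are a priori unrelated; see
   [continuous_operations]. *)
#[short(type="metricLmodType")]
HB.structure Definition MetricLmodule (R : numDomainType) :=
  {Y of Metric R Y & GRing.Lmodule R Y}.

(* Continuity of the opposite is the case of scaling by -1. The metric is required
   neither to be translation invariant nor to come from a norm. *)
Definition continuous_operations (R : numFieldType) (Y : metricLmodType R) :=
  continuous (fun yz : Y * Y => yz.1 + yz.2) /\
  continuous (fun ay : R^o * Y => ay.1 *: ay.2).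

(* A set-valued mapping from A to B is a function A -> set B. *)
Definition dom (A B : Type) (M : A -> set B) : set A := [set a | M a !=set0].

Definition gph (A B : Type) (M : A -> set B) : set (A * B) :=
  [set ab | M ab.1 ab.2].

Section moduli.
Context {R : realType}.

(* Equal to +oo when Omega is empty, by [ereal_inf0]. *)
Definition dist_set (X : metricType R) (x : X) (Omega : set X) : \bar R :=
  ereal_inf [set (mdist x z)%:E | z in Omega].

Context {P X : metricType R}.
Implicit Types (M : P -> set X) (pbar : P) (xbar : X).

(* In the two moduli below, the infimum is +oo if there is no such k. *)
Definition lipusc M pbar : \bar R :=
  ereal_inf [set k%:E | k in [set k : R | 0 <= k /\
    exists2 V : set P, nbhs pbar V &
      forall p x, V p -> M p x ->
        (dist_set x (M pbar) <= (k * mdist p pbar)%:E)%E]].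

Definition clm M pbar xbar : \bar R :=
  ereal_inf [set k%:E | k in [set k : R | 0 <= k /\
    exists V : set P, exists U : set X, [/\ nbhs pbar V, nbhs xbar U &
      forall p x, V p -> (M p `&` U) x ->
        (dist_set x (M pbar) <= (k * mdist p pbar)%:E)%E]]].

(* Not to be confused with [topology.locally_compact], which is about sets. *)
Definition locally_compact_around M pbar : Prop :=
  exists2 V : set P, nbhs pbar V &
    exists2 K : set X, compact K & \bigcup_(p in V) M p `<=` K.

End moduli.

Definition sol_GE (X P : Type) (Y : zmodType) (f : X * P -> Y)
    (F : X -> set Y) : P -> set X :=
  fun p => [set x | [set f (x, p) + v | v in F x] 0].

(* Main.v *)
(** The inequality "sup of clm <= Lipusc" holds for every mapping. Conversely,
    let k exceed all calmness moduli. Near (pbar, x) the bound with constant k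
    holds by calmness if x lies in M pbar, and vacuously otherwise since the graph
    is closed; compactness makes these local bounds uniform in x. Closedness of the
    graph of the solution mapping comes from (x, p) |-> (x, - f (x, p)), which pulls
    the graph of F back to it. *)

Require Import Defs.
From HB Require Import structures.
From mathcomp Require Import all_boot all_order all_algebra.
From mathcomp Require Import boolp classical_sets reals ereal topology.

Set Implicit Arguments.
Unset Strict Implicit.
Unset Printing Implicit Defensive.

Import Order.TTheory GRing.Theory Num.Theory.
Import numFieldTopology.Exports.

Local Open Scope classical_set_scope.
Local Open Scope ring_scope.

Section moduli_comparison.
Context {R : realType} {P X : metricType R}.
Implicit Types (M : P -> set X) (p pbar : P) (x xbar : X).

Lemma clm_ge0 M pbar xbar : (0 <= clm M pbar xbar)%E.
Proof. by apply: le_ereal_inf_tmp => _ [k [k0 _] <-]; rewrite lee_fin. Qed.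

(** Any constant admissible for [lipusc] is admissible for [clm], with the whole space as [U]. *)
Lemma clm_le_lipusc M pbar xbar : (clm M pbar xbar <= lipusc M pbar)%E.
Proof.
apply: ereal_inf_le_tmp => _ [k [k0 [V nV VM]] <-]; exists k => //; split => //.
exists V, setT; split => //; first exact: filterT.
by move=> p x Vp [Mpx _]; exact: VM.
Qed.

(** Strictness provides an admissible [l < k], which can be enlarged to [k] since distances are
    nonnegative. *)
Lemma clm_lt_near M pbar xbar (k : R) : (clm M pbar xbar < k%:E)%E ->
  \forall x \near xbar & p \near pbar,
    M p x -> (dist_set x (M pbar) <= (k * mdist p pbar)%:E)%E.
Proof.
move=> /ereal_inf_lt[_ [l [l0 [V [U [nV nU VU]]]] <-]]; rewrite lte_fin => lk.
exists (U, V) => // -[x p] [/= Ux Vp] Mpx.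
apply: (le_trans (VU p x Vp _)) => //.
by rewrite lee_fin ler_wpM2r ?mdist_ge0// ltW.
Qed.

Lemma lipusc_le_near M pbar (k : R) : 0 <= k ->
  (\forall p \near pbar, forall x, M p x ->
    (dist_set x (M pbar) <= (k * mdist p pbar)%:E)%E) ->
  (lipusc M pbar <= k%:E)%E.
Proof.
move=> k0 nk; apply: ereal_inf_lbound; exists k => //; split => //.
by eexists; [exact: nk|move=> p x; exact].
Qed.

(** The complement of the graph is open, so it contains a product neighborhood of [(pbar, xbar)]. *)
Lemma closed_gph_near M pbar xbar : closed (gph M) -> ~ M pbar xbar ->
  \forall x \near xbar & p \near pbar, ~ M p x.
Proof.
move=> clM Mx.
have : nbhs (pbar, xbar) (~` gph M).
  by apply: open_nbhs_nbhs; split; [exact: closed_openC|].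
move=> [[V U] [/= nV nU] VU]; exists (U, V) => // -[x p] [/= Ux Vp].
exact: (VU (p, x)).
Qed.

Theorem lipusc_sup_clm M pbar : closed (gph M) -> dom M pbar ->
  locally_compact_around M pbar ->
  lipusc M pbar = ereal_sup [set clm M pbar x | x in M pbar].
Proof.
move=> clM [x0 Mx0] [V nV [K cK VK]]; apply/eqP; rewrite eq_le; apply/andP; split.
- have clm_sup x : M pbar x ->
      (clm M pbar x <= ereal_sup [set clm M pbar x | x in M pbar])%E.
    by move=> Mx; apply: ereal_sup_ubound; exists x.
  have sup_ge0 := le_trans (clm_ge0 M pbar x0) (clm_sup _ Mx0).
  (* The value [-oo] is excluded by [sup_ge0]; for [+oo] the bound is trivial. *)
  move: (ereal_sup _) clm_sup sup_ge0 => [s| |] // clm_s s0; last exact: leey.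
  (* The slack [e] puts [s + e] strictly above every calmness modulus, as [clm_lt_near] requires. *)
  apply/lee_addgt0Pr => e e0; rewrite -EFinD.
  apply: lipusc_le_near; first by rewrite addr_ge0// ltW.
  have near_K : \forall p \near pbar, K `<=` (fun x => M p x ->
      (dist_set x (M pbar) <= ((s + e) * mdist p pbar)%:E)%E).
    (* By compactness, bounds on products of neighborhoods give one neighborhood of [pbar] that
       serves all of [K]. *)
    move/compact_near_coveringP: cK; apply => x _.
    have [Mx|Mx] := pselect (M pbar x).
      apply: clm_lt_near; apply: (le_lt_trans (clm_s x Mx)).
      by rewrite lte_fin ltrDl.
    by apply: filterS (closed_gph_near clM Mx) => -[y p] /= ? ?.
  (* For [p] in [V] the whole of [M p] lies in [K]. *)
  apply: filterS2 nV near_K => p Vp Kp x Mpx.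
  by apply: Kp => //; apply: VK; exists p.
- by apply: ge_ereal_sup => _ [x _ <-]; exact: clm_le_lipusc.
Qed.

End moduli_comparison.

Lemma closed_gph_sol_GE (R : realType) (X P : topologicalType)
    (Y : metricLmodType R) (f : X * P -> Y) (F : X -> set Y) :
  continuous_operations Y -> continuous f -> closed (gph F) ->
  closed (gph (sol_GE f F)).
Proof.
move=> [_ contZ] contf clF.
have contN : continuous (fun y : Y => - y).
  move=> y; have -> : (fun y : Y => - y) = (fun y => (-1 : R^o) *: y).
    by apply/funext => z; rewrite scaleN1r.
  apply: (@continuous2_cvg _ _ _ _ _ _ (fun=> (-1 : R^o)) id
    (fun (a : R^o) (y : Y) => a *: y)).
  - exact: (contZ (-1 : R^o, y)).
  - exact: cvg_cst.
  - exact: cvg_id.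
(* The equation [f (x, p) + v = 0] forces [v = - f (x, p)]. Coordinates are swapped because [f]
   takes [(x, p)] while the graph consists of pairs [(p, x)]. *)
have -> : gph (sol_GE f F) =
    (fun px : P * X => (px.2, - f (px.2, px.1))) @^-1` gph F.
  apply/seteqP; split=> -[p x]; rewrite /gph /sol_GE /=.
    by move=> [v Fv /eqP]; rewrite addrC addr_eq0 => /eqP <-.
  by move=> Fx; exists (- f (x, p)); rewrite ?subrr.
apply: preimage_closed => // -[p x] _.
have swapE : (fun px : P * X => (px.2, px.1)) @ (p, x) --> (x, p).
  by apply: cvg_pair; [exact: cvg_snd|exact: cvg_fst].
apply: cvg_pair; first exact: cvg_snd.
apply: (@cvg_comp _ _ _ (fun px : P * X => f (px.2, px.1)) (fun y : Y => - y)
  _ (nbhs (f (x, p)))); last exact: contN.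
exact: cvg_comp swapE (contf (x, p)).
Qed.

Theorem theorem3 (R : realType) (X P : metricType R) (Y : metricLmodType R)
    (f : X * P -> Y) (F : X -> set Y) (pbar : P) :
  continuous_operations Y ->
  continuous f ->
  closed (gph F) ->
  dom (sol_GE f F) pbar ->
  locally_compact_around (sol_GE f F) pbar ->
  lipusc (sol_GE f F) pbar =
    ereal_sup [set clm (sol_GE f F) pbar x | x in sol_GE f F pbar].
Proof.
move=> contY contf clF Spbar lcS.
by apply: lipusc_sup_clm => //; exact: closed_gph_sol_GE.
Qed.
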